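(* Let $p$ be an odd prime and let $G=\langle x,y\rangle$ be a metabelian $p$-group with $G/G'\simeq(p,p)$, of nilpotency class $m-1$ and coclass $e-1\ge 2$, with defect of commutativity $k=0$ (that is, with $\Sigma_3\cap T_3=1$ and with the generator normalization described in the context). For $3\le j\le m$ and $3\le\ell\le e+1$ put $P_{j,\ell}=\Sigma_j\times T_\ell$. Then Blackburn's two-step centralizers of $G$ are $$\chi_j(G)=\begin{cases}G' & \text{for } 1\le j\le e-1,\\ \langle y,G'\rangle & \text{for } e\le j\le m-2,\\ G & \text{for } j\ge m-1;\end{cases}$$ in particular, none of the maximal subgroups of $G$ occurs as a two-step centralizer when $e=m-1$. Moreover: (1) The factors of the lower central series are $$\gamma_j(G)/\gamma_{j+1}(G)\simeq\begin{cases}(p,p) & \text{for } j=1 \text{ and } 3\le j\le e,\\ (p) & \text{for } j=2 \text{ and } e+1\le j\le m-1.\end{cases}$$ (2) The terms of the lower central series are $$\gamma_j(G)=\begin{cases}\langle x,y,G'\rangle & \text{for } j=1,\\ \langle s_2,\gamma_3(G)\rangle & \text{for } j=2,\\ P_{j,j} & \text{for } 3\le j\le e,\\ \Sigma_j & \text{for } e+1\le j\le m-1.\end{cases}$$ (3) The factors of the upper central series are $$\zeta_j(G)/\zeta_{j-1}(G)\simeq\begin{cases}(p,p) & \text{for } 1\le j\le e-2 \text{ and } j=m-1,\\ (p) & \text{for } e-1\le j\le m-2.\end{cases}$$ (4) The terms of the upper central series are $$\zeta_j(G)=\begin{cases}P_{m-j,\,e+1-j} & \text{for } 1\le j\le e-2,\\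 P_{m-j,\,3} & \text{for } e-1\le j\le m-3,\\ \langle s_2,\zeta_{m-3}(G)\rangle & \text{for } j=m-2,\\ \langle x,y,\zeta_{m-2}(G)\rangle & \text{for } j=m-1.\end{cases}$$
   Context: Commutators: $[a,b]=a^{-1}b^{-1}ab$. A finite $p$-group is metabelian if its commutator subgroup $G'$ is abelian. $(p,p)$ denotes the elementary abelian group of order $p^2$ and $(p)$ the cyclic group of order $p$. Lower central series: $\gamma_1(G)=G$, $\gamma_j(G)=[\gamma_{j-1}(G),G]$ for $j\ge 2$. Upper central series: $\zeta_0(G)=1$ and $\zeta_j(G)/\zeta_{j-1}(G)=\mathrm{Centre}(G/\zeta_{j-1}(G))$ for $j\ge 1$. Setting. $p$ is an odd prime and $G=\langle x,y\rangle$ is a finite two-generator metabelian $p$-group with $G/G'\simeq(p,p)$, of order $p^n$, nilpotency class $m-1$ (so $\gamma_{m-1}(G)\ne 1=\gamma_m(G)$) and coclass $n-(m-1)=e-1\ge 2$; thus $e\ge 3$ and $n=m+e-2$. Put $s_2=t_2=[y,x]$, $s_j=[s_{j-1},x]$ and $t_j=[t_{j-1},y]$ for $j\ge 3$, and $\Sigma_j=\langle s_j,\ldots,s_{m-1}\rangle$, $T_\ell=\langle t_\ell,\ldots,t_{e+1}\rangle$ for $j,\ell\ge 3$ (so $\Sigma_m=1$). One has $\gamma_2(G)=\langle s_2,\gamma_3(G)\rangle$ and, in the case considered, $t_3\notin\Sigma_3$ and $\gamma_3(G)=\langle s_3,t_3,\gamma_4(G)\rangle$. Defect of commutativity $k=0$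 means: $t_{e+1}=1$ (so $T_{e+1}=1$) and $\Sigma_3\cap T_3=1$. The generators $x,y$ are taken such that $[s_j,y]=1$ for all $j\ge 3$ and $[t_\ell,x]=1$ for all $\ell\ge 3$. Two-step centralizers: for $j\ge 1$, $\chi_j(G)$ is the biggest subgroup $H$ with $G'\le H\le G$ such that $[\gamma_j(G),H]\le\gamma_{j+2}(G)$. Case ranges such as $e\le j\le m-2$ are empty when the lower bound exceeds the upper bound. *)

(* Defs.v *)
From mathcomp Require Import all_boot all_fingroup all_solvable.

Set Implicit Arguments.
Unset Strict Implicit.
Unset Printing Implicit Defensive.

Import GroupScope.

Section Defs.

Variable gT : finGroupType.
Implicit Types (x y : gT) (A : {set gT}) (G H : {group gT}).

(* iter_comm c z 2 = c and iter_comm c z j.+1 = [~ iter_comm c z j, z] for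
   j >= 2; only indices j >= 2 are meaningful. *)
Definition iter_comm (c z : gT) (j : nat) : gT :=
  iter (j - 2) (fun u => [~ u, z]) c.

Definition s_ x y (j : nat) : gT := iter_comm [~ y, x] x j.
Definition t_ x y (j : nat) : gT := iter_comm [~ y, x] y j.

(* Sigma_ x y m j = <s_j, ..., s_(m-1)> and T_ x y e l = <t_l, ..., t_(e+1)>,
   trivial when the list of generators is empty. *)
Definition Sigma_ x y (m j : nat) : {set gT} :=
  <<[set s_ x y i | i : 'I_m & j <= i]>>.
Definition T_ x y (e l : nat) : {set gT} :=
  <<[set t_ x y i | i : 'I_e.+2 & l <= i]>>.

(* The operator \x is set0 when its operands do not form an internal direct
   product, so an equality P_ x y m e j l = 'L_j(G) includes directness. *)
Definition P_ x y (m e j l : nat) : {set gT} := Sigma_ x y m j \x T_ x y e l.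

Definition commutativity_defect0 x y (m e : nat) : Prop :=
  t_ x y e.+1 = 1 /\ Sigma_ x y m 3 :&: T_ x y e 3 = 1.

Definition centralizes_two_steps (j : nat) G H : bool :=
  [&& G^`(1) \subset H, H \subset G & [~: 'L_j(G), H] \subset 'L_j.+2(G)].

(* The join of all the candidates; two_step_centralizer_max shows that it is
   the biggest of them. *)
Definition two_step_centralizer (j : nat) G : {set gT} :=
  <<\bigcup_(H : {group gT} | centralizes_two_steps j G H) H>>.

Definition is_type_pp (p : nat) (rT : finGroupType) (A : {set rT}) : bool :=
  p.-abelem A && (#|A| == p ^ 2)%N.
Definition is_type_p (p : nat) (rT : finGroupType) (A : {set rT}) : bool :=
  cyclic A && (#|A| == p).

Canonical two_step_centralizer_group j G := [group of two_step_centralizer j G].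

Lemma two_step_centralizer_max (j : nat) G : 0 < j ->
  centralizes_two_steps j G (two_step_centralizer_group j G) /\
  forall H, centralizes_two_steps j G H -> H \subset two_step_centralizer j G.
Proof.
case: j => // j _; have nLG i : G \subset 'N('L_i(G)) := lcn_norm i G.
have max H : centralizes_two_steps j.+1 G H ->
    H \subset two_step_centralizer j.+1 G.
  by move=> cH; rewrite sub_gen // (bigcup_max H).
have cG' : centralizes_two_steps j.+1 G G^`(1)%G.
  rewrite /centralizes_two_steps subxx der_sub /= commGC.
  have nR (A B : {set gT}) : A \subset G -> B \subset G -> [~: A, B] / 'L_j.+3(G) =
      [~: A / 'L_j.+3(G), B / 'L_j.+3(G)].
    by move=> sA sB; rewrite quotientR // (subset_trans _ (nLG _)).
  have sL := lcn_sub j.+1 G; have sL2 := lcn_sub j.+2 G.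
  rewrite -quotient_sub1; last first.
    by rewrite (subset_trans _ (nLG j.+3)) // comm_subG ?der_sub.
  rewrite !nR ?der_sub //; apply/trivgP.
  have c1 : [~: 'L_j.+1(G) / 'L_j.+3(G), G / 'L_j.+3(G), G / 'L_j.+3(G)] = 1.
    by rewrite -!nR // trivg_quotient.
  by apply: three_subgroup => //=; rewrite [X in [~: X, _]]commGC.
split=> //; apply/and3P; split=> /=; first exact: max cG'.
  by rewrite gen_subG; apply/bigcupsP=> H /and3P[].
have sLN : 'L_j.+1(G) \subset 'N('L_j.+3(G)).
  exact: subset_trans (lcn_sub _ _) (nLG _).
have sXG : two_step_centralizer j.+1 G \subset G.
  by rewrite gen_subG; apply/bigcupsP=> H /and3P[].
have nX := subset_trans sXG (nLG j.+3).
rewrite commGC -quotient_cents2 // sub_quotient_pre // gen_subG.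
apply/bigcupsP=> H /and3P[_ sHG cH]; have nH := subset_trans sHG (nLG j.+3).
by rewrite -sub_quotient_pre // quotient_cents2 // commGC.
Qed.

End Defs.

(* Main.v *)
(* As G' is abelian, u |-> [u, g] is an endomorphism of G' for g in G;
   commutation with x shifts the generators s_j of Sigma_3 and kills T_3,
   commutation with y shifts the generators t_l of T_3 and kills Sigma_3.
   By nilpotency gamma_3 = Sigma_3 T_3, hence gamma_j = Sigma_j T_j for j >= 3.
   Since s_j^p lies in Sigma_{j+1} and t_l^p in T_{l+1}, consecutive terms have
   index at most p, which gives |G| <= p^3 p^(m-3) p^(min(m, e+1)-3).  As
   |G| = p^(m+e-2), equality holds everywhere and e + 1 <= m.  So all indices
   are exactly p, the shifts are injective modulo the next terms, and two-step
   centralizers and upper central terms can be read off. *)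
Require Import Defs.
From mathcomp Require Import all_boot all_fingroup all_solvable.
From mathcomp Require Import zify.
Import GroupScope.

Set Implicit Arguments.
Unset Strict Implicit.
Unset Printing Implicit Defensive.

(** * Extensions of index p, commutators modulo a normal subgroup, and factors of type (p) and
    (p,p) *)

Section GroupFacts.

Variable gT : finGroupType.
Implicit Types (p : nat) (a g u v x y z : gT) (G H K B : {group gT}).

Lemma card_adjoin_dvdn p K a :
  a \in 'N(K) -> a ^+ p \in K -> #|<<a |: K>>| %| p * #|K|.
Proof.
move=> nKa Kap; have nKA : <[a]> \subset 'N(K) by rewrite cycle_subG.
have -> : <<a |: K>> = <[a]> <*> K by rewrite joing_idl.
rewrite -(Lagrange (joing_subr <[a]> K)) mulnC dvdn_pmul2r ?cardG_gt0 //.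
rewrite -card_quotient ?join_subG ?nKA ?normG //.
by rewrite quotientYidr // quotient_cycle // order_dvdn -morphX //= coset_id.
Qed.

(** An index dividing p leaves nothing strictly between [K] and [B], and [u] witnesses that [H] is
    not [B]. Subgroups cut out by a commutator condition are identified below in this way: one
    inclusion and one excluded element suffice. *)
Lemma prime_index_eq p K H B u :
    prime p -> K \subset H -> H \subset B -> #|B| %| p * #|K| ->
  u \in B -> u \notin H -> H :=: K.
Proof.
move=> p_pr sKH sHB; rewrite -(Lagrange sHB) -(Lagrange sKH).
rewrite -mulnA mulnC dvdn_pmul2r ?cardG_gt0 // => dv Bu Hu.
apply/eqP; rewrite eq_sym eqEsubset sKH -indexg_eq1.
have /primeP[_ /(_ #|H : K|)] := p_pr.
case/(_ (dvdn_trans (dvdn_mulr _ (dvdnn _)) dv))/orP => // /eqP eHK.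
move: dv; rewrite eHK -{2}[p]muln1 dvdn_pmul2l ?prime_gt0 // dvdn1 indexg_eq1.
by move=> sBH; rewrite (subsetP sBH) in Hu.
Qed.

(** Closure comes from [u, gh] = [u, h] [u, g]^h. Packaged as a group so that the condition need
    only be checked on generators; the next lemma does the same in the other argument. *)
Lemma comm_mod_group_set G K u :
  G \subset 'N(K) -> group_set [set g in G | [~ u, g] \in K].
Proof.
move=> nKG; apply/group_setP; split=> [|g h]; rewrite !inE ?commg1 ?group1 //.
move=> /andP[Gg Kg] /andP[Gh Kh]; rewrite groupM //= commgMJ groupM //.
by rewrite memJ_norm // (subsetP nKG).
Qed.

Lemma mod_comm_group_set G K g :
  G \subset 'N(K) -> group_set [set u in G | [~ u, g] \in K].
Proof.
move=> nKG; apply/group_setP; split=> [|u v]; rewrite !inE ?comm1g ?group1 //.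
move=> /andP[Gu Ku] /andP[Gv Kv]; rewrite groupM //= commMgJ groupM //.
by rewrite memJ_norm // (subsetP nKG).
Qed.

Lemma comm_gen2 G K u x y :
    G \subset 'N(K) -> G :=: <<[set x; y]>> -> [~ u, x] \in K ->
  [~ u, y] \in K -> forall g, g \in G -> [~ u, g] \in K.
Proof.
move=> nKG defG Kx Ky g Gg.
have : G \subset Group (comm_mod_group_set u nKG).
  have : [set x; y] \subset G by rewrite defG subset_gen.
  rewrite {2}defG gen_subG !subUset !sub1set !inE => /andP[-> ->].
  by rewrite Kx Ky.
by move/subsetP/(_ _ Gg); rewrite inE => /andP[].
Qed.

Lemma mem_norm_comm K z : (forall u, u \in K -> [~ u, z] \in K) -> z \in 'N(K).
Proof.
move=> Kz; rewrite inE; apply/subsetP=> _ /imsetP[u Ku ->].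
by rewrite conjg_mulR groupM ?Kz.
Qed.

(** In the nilpotent group [G / K] a nontrivial normal subgroup properly contains its commutator
    with the whole group, whereas the image of [H] lies in that of [[~: H, G]]. Hence this image is
    trivial. *)
Lemma nil_sub_comm G H K :
    nilpotent G -> H \subset G -> G \subset 'N(H) -> G \subset 'N(K) ->
  H \subset K * [~: H, G] -> H \subset K.
Proof.
move=> nilG sHG nHG nKG sHK; have nKH := subset_trans sHG nKG.
rewrite -quotient_sub1 //; apply/trivgP/eqP; apply/idPn => ntH.
have nQ : G / K \subset 'N_(G / K)(H / K) by rewrite subsetI subxx quotient_norms.
have := nil_comm_properl (quotient_nil K nilG) (quotientS K sHG) ntH nQ.
rewrite -quotientR // properE => /andP[_ /negP[]].
by rewrite -(quotientMidl K [~: H, G]) quotientS.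
Qed.

Lemma is_type_p_quotient p K B :
    prime p -> B \subset 'N(K) -> K \subset B -> #|B| = (p * #|K|)%N ->
  is_type_p p (B / K).
Proof.
move=> p_pr nKB sKB oB; have oBK : #|B / K| = p.
  by rewrite card_quotient // -divgS // oB mulnK.
by rewrite /is_type_p oBK eqxx andbT prime_cyclic ?oBK.
Qed.

Lemma is_type_pp_quotient p K B :
    prime p -> abelian B -> K \subset B -> #|B| = (p ^ 2 * #|K|)%N ->
  (forall u, u \in B -> u ^+ p \in K) -> is_type_pp p (B / K).
Proof.
move=> p_pr cBB sKB oB pB; have nKB := sub_abelian_norm cBB sKB.
apply/andP; split; last by rewrite card_quotient // -divgS // oB mulnK.
apply/(abelemP p_pr); split=> [|_ /morphimP[u nKu Bu ->]].
  exact: quotient_abelian.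
by rewrite -morphX //= coset_id ?pB.
Qed.

Lemma two_step_centralizer_eq j G H :
    centralizes_two_steps j G H ->
    (forall K, centralizes_two_steps j G K -> K \subset H) ->
  two_step_centralizer j G = H.
Proof.
move=> cH maxH; apply/eqP; rewrite eqEsubset gen_subG.
apply/andP; split; first by apply/bigcupsP=> K /maxH.
by rewrite sub_gen // (bigcup_max H).
Qed.

End GroupFacts.

(** * Descending chains generated by iterated commutators with a fixed element *)

Section CommutatorChain.

Variables (gT : finGroupType) (A : {group gT}) (z : gT) (a : nat -> gT).
Variables (M N : nat).

(** Common form of [Sigma_] (with [M = m]) and [T_] (with [M = e.+2]). The bound [N] introduced
    below, from which on [a] is trivial, is kept apart from [M] because t_(e+1) is listed among the
    generators of [T_] although it is 1. *)
Definition chain (j : nat) : {set gT} := <<[set a i | i : 'I_M & j <= i]>>.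
Canonical chain_group j := [group of chain j].

Hypotheses (cAA : abelian A) (Aa : forall i, 2 <= i -> a i \in A).
Hypothesis aS : forall i, 2 <= i -> a i.+1 = [~ a i, z].
Hypotheses (le_NM : N <= M) (a_tail : forall i, N <= i -> a i = 1).

Lemma mem_chain i j : j <= i -> a i \in chain j.
Proof.
move=> le_ji; have [le_Ni | lt_iN] := leqP N i; first by rewrite a_tail.
by apply/mem_gen/imsetP; exists (Ordinal (leq_trans lt_iN le_NM)); rewrite ?inE.
Qed.

Lemma chain_subP j (H : {group gT}) :
  (forall i, j <= i -> a i \in H) -> chain j \subset H.
Proof.
by move=> Ha; rewrite gen_subG; apply/subsetP=> _ /imsetP[i + ->]; rewrite inE => /Ha.
Qed.

Lemma chain_leq j k : j <= k -> chain k \subset chain j.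
Proof. by move=> le_jk; apply: chain_subP => i /(leq_trans le_jk)/mem_chain. Qed.

Lemma chain_sub j : 2 <= j -> chain j \subset A.
Proof. by move=> j2; apply: chain_subP => i /(leq_trans j2)/Aa. Qed.

Lemma chain_norm j : 2 <= j -> A \subset 'N(chain j).
Proof. by move/chain_sub; apply: sub_abelian_norm. Qed.

Lemma chain1 j : N <= j -> chain j = 1.
Proof.
move=> le_Nj; apply/trivgP/chain_subP=> i /(leq_trans le_Nj)/a_tail ->.
exact: group1.
Qed.

Lemma chainS j : chain j = <<a j |: chain j.+1>>.
Proof.
apply/eqP; rewrite eqEsubset gen_subG; apply/andP; split; last first.
  by rewrite gen_subG subUset sub1set mem_chain // chain_leq.
apply/subsetP=> _ /imsetP[i + ->]; rewrite inE leq_eqVlt => /predU1P[<-|lt_ji].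
  by rewrite mem_gen ?setU11.
by rewrite mem_gen // inE mem_chain ?orbT.
Qed.

Lemma chain_comm u j : 2 <= j -> u \in chain j -> [~ u, z] \in chain j.+1.
Proof.
move=> j2 Cu; have nC : A \subset 'N(chain j.+1) by apply: chain_norm; lia.
have : chain j \subset Group (mod_comm_group_set z nC).
  apply: chain_subP => i le_ji; rewrite inE Aa; last by lia.
  by rewrite -aS ?mem_chain //; lia.
by move/subsetP/(_ _ Cu); rewrite inE => /andP[].
Qed.

Lemma chain_comm1 w u j :
  (forall i, 3 <= i -> [~ a i, w] = 1) -> 3 <= j -> u \in chain j -> [~ u, w] = 1.
Proof.
move=> aw j3 Cu; have : chain j \subset 'C[w].
  by apply: chain_subP => i le_ji; apply/cent1P/commgP/eqP/aw/(leq_trans j3).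
by move/subsetP/(_ _ Cu)/cent1P/commgP/eqP.
Qed.

Variable p : nat.
Hypotheses (p_pr : prime p) (ap : forall i, 3 <= i -> a i ^+ p \in chain i.+1).

Lemma card_chainS j : 3 <= j -> #|chain j| %| p * #|chain j.+1|.
Proof.
move=> j3; rewrite chainS card_adjoin_dvdn ?ap //.
by rewrite (subsetP (chain_norm _)) ?Aa //; lia.
Qed.

Lemma card_chain_dvdn j : 3 <= j -> #|chain j| %| p ^ (N - j).
Proof.
have [k] := ubnP (N - j); elim: k j => // k IHk j lt_k j3.
have [le_Nj | lt_jN] := leqP N j; first by rewrite chain1 ?cards1.
apply: dvdn_trans (card_chainS j3) _.
have -> : (N - j = (N - j.+1).+1)%N by lia.
by rewrite expnS dvdn_mul // IHk //; lia.
Qed.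

Hypothesis oC3 : #|chain 3| = (p ^ (N - 3))%N.

(** Each of the N - 3 steps has index at most p, so attaining p^(N-3) at the top forces every index
    to be exactly p. *)
Lemma card_chain j : 3 <= j <= N -> #|chain j| = (p ^ (N - j))%N.
Proof.
elim: j => // j IHj /andP[j3 le_jN].
move: j3; rewrite leq_eqVlt => /predU1P[<- // | j3].
apply/eqP; rewrite eqn_dvd card_chain_dvdn /=; last by lia.
have := card_chainS j3; rewrite IHj; last by lia.
by rewrite -[(N - j)%N]prednK ?subn_gt0 // expnS dvdn_pmul2l ?prime_gt0 // subnS.
Qed.

Lemma card_chain_pS j : 3 <= j < N -> #|chain j| = (p * #|chain j.+1|)%N.
Proof.
move=> jN; rewrite !card_chain -?expnS; try lia.
by congr (p ^ _)%N; lia.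
Qed.

Lemma chain_notin j : 3 <= j < N -> a j \notin chain j.+1.
Proof.
move=> jN; apply/negP=> Ca; have := card_chain_pS jN.
rewrite {1}chainS (setUidPr _) ?sub1set // genGid.
by apply/eqP; rewrite neq_ltn ltn_Pmull ?cardG_gt0 ?prime_gt1.
Qed.

Lemma chain_expp j u : 3 <= j < N -> u \in chain j -> u ^+ p \in chain j.+1.
Proof.
move=> jN Cu; have nCa : chain j \subset 'N(chain j.+1).
  by apply: subset_trans (chain_norm _); rewrite ?chain_sub //; lia.
have nCu := subsetP nCa _ Cu.
apply: coset_idr; rewrite ?groupX // morphX //; apply/eqP.
have oQ : #|chain j / chain j.+1| = p.
  by rewrite card_quotient // -divgS ?chain_leq // card_chain_pS // mulnK.
by rewrite -order_dvdn -oQ order_dvdG // mem_quotient.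
Qed.

(** Commutation with [z] is injective from each factor of the chain to the next, so [u] descends one
    term at a time from [chain 3] to [chain i]. *)
Lemma chain_comm_inv u i :
  3 <= i < N -> u \in chain 3 -> [~ u, z] \in chain i.+1 -> u \in chain i.
Proof.
move=> iN C3u Cuz; suff main k : 3 <= k <= i -> u \in chain k by apply: main; lia.
elim: k => // k IHk /andP[k3 lt_ki].
move: k3; rewrite leq_eqVlt => /predU1P[<- // | k3].
have Cu : u \in chain k by apply: IHk; lia.
have nC : chain k \subset 'N(chain k.+2).
  by apply: subset_trans (chain_norm _); rewrite ?chain_sub //; lia.
have kN : 3 <= k < N by lia.
have k1N : 3 <= k.+1 < N by lia.
(* The elements of [chain k] whose commutator with [z] is in [chain k.+2] include [chain k.+1] but
   not [a k], since [a k.+1] is outside [chain k.+2]; index p then decides. *)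
suff <- : Group (mod_comm_group_set z nC) :=: chain k.+1.
  by rewrite inE Cu (subsetP (chain_leq _) _ Cuz).
apply: (@prime_index_eq _ p (chain_group k.+1) _ (chain_group k) (a k)) => //.
- apply/subsetP=> v Cv; rewrite inE chain_comm ?andbT //; try lia.
  exact: (subsetP (chain_leq (leqnSn k))).
- by apply/subsetP=> v; rewrite inE => /andP[].
- by rewrite card_chain_pS.
- exact: mem_chain.
by rewrite inE mem_chain //= -aS ?chain_notin //; lia.
Qed.

End CommutatorChain.

(** * The group [G] with defect zero: order, class, and the sequences s_j and t_l *)

Section DefectZero.

Variables (p : nat) (gT : finGroupType) (G : {group gT}) (x y : gT) (n m e : nat).
Hypotheses (p_pr : prime p) (G_pgroup : p.-group G).
Hypothesis G_gen : G :=: <<[set x; y]>>.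
Hypotheses (cAA : abelian G^`(1)) (G_ab : is_type_pp p (G / G^`(1))).
Hypotheses (G_order : #|G| = (p ^ n)%N) (G_class : nil_class G = (m - 1)%N).
Hypotheses (G_coclass : (n - (m - 1))%N = (e - 1)%N) (e_ge3 : 2 <= e - 1).
Hypothesis L3_gen : 'L_3(G) = <<[set s_ x y 3; t_ x y 3] :|: 'L_4(G)>>.
Hypothesis t_last : t_ x y e.+1 = 1.
Hypothesis TI3 : chain (s_ x y) m 3 :&: chain (t_ x y) e.+2 3 = 1.
Hypothesis s_comm_y : forall j, 3 <= j -> [~ s_ x y j, y] = 1.
Hypothesis t_comm_x : forall l, 3 <= l -> [~ t_ x y l, x] = 1.

Local Notation s := (s_ x y).
Local Notation t := (t_ x y).
Local Notation S := (chain_group s m).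
Local Notation T := (chain_group t e.+2).
Local Notation A := (derived_at_group G 1).
(** The group underlying [P_ x y m e i l], taken as a join so that it is available before directness
    is established in [PE]. *)
Local Notation R i l := (joing_group (S i) (T l)).

Lemma gen_memx : x \in G. Proof. by rewrite G_gen mem_gen ?set21. Qed.
Lemma gen_memy : y \in G. Proof. by rewrite G_gen mem_gen ?set22. Qed.
Hint Resolve gen_memx gen_memy : core.

Lemma norm_lcn i : G \subset 'N('L_i(G)). Proof. exact: lcn_norm. Qed.
Hint Resolve norm_lcn : core.

Lemma G_nil : nilpotent G. Proof. exact: pgroup_nil G_pgroup. Qed.

Lemma card_G : #|G| = (p ^ 2 * #|A|)%N.
Proof.
have /andP[_ /eqP <-] := G_ab.
by rewrite card_quotient ?der_norm // mulnC Lagrange ?der_sub.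
Qed.

Lemma expp_der1 g : g \in G -> g ^+ p \in A.
Proof.
move=> Gg; have /andP[/(abelemP p_pr)[_ pQ] _] := G_ab.
have nAg := subsetP (der_norm 1 G) _ Gg.
by rewrite coset_idr ?groupX // morphX // pQ ?mem_quotient.
Qed.

(** The subtraction in [m - 1] is truncated, so small [m] has to be ruled out: class 0 would make
    [G] trivial, although p^2 divides its order. *)
Lemma class_gt1 : 1 < m.
Proof.
rewrite ltnNge; apply/negP=> m1; have : nil_class G == 0 by rewrite G_class; lia.
rewrite nil_class0 => /eqP G1; have := card_G.
rewrite {1}G1 cards1 => p2A; have : p %| 1 by rewrite p2A -mulnn -mulnA dvdn_mulr.
by rewrite dvdn1 eqn_leq leqNgt prime_gt1.
Qed.

Lemma lcn_class : 'L_m(G) = 1.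
Proof.
have m1 := class_gt1; have : nil_class G <= m - 1 by rewrite G_class.
by move/(lcn_nil_classP _ G_nil); rewrite subn1 prednK //; lia.
Qed.

Lemma sS j : 2 <= j -> s j.+1 = [~ s j, x].
Proof. by case: j => [|[|j]] // _; rewrite /s_ /iter_comm !subSS !subn0. Qed.

Lemma tS j : 2 <= j -> t j.+1 = [~ t j, y].
Proof. by case: j => [|[|j]] // _; rewrite /t_ /iter_comm !subSS !subn0. Qed.

Lemma lcn_comm j u g : 0 < j ->
  u \in 'L_j(G) -> g \in G -> [~ u, g] \in 'L_j.+1(G).
Proof. by case: j => // j _ Lu Gg; rewrite lcnSn mem_commg. Qed.

Lemma s_lcn j : 2 <= j -> s j \in 'L_j(G).
Proof.
elim: j => // j IHj; rewrite leq_eqVlt => /predU1P[<-|lt2j].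
  by rewrite lcn2 mem_commg.
by rewrite sS // lcn_comm ?IHj //; lia.
Qed.

Lemma t_lcn j : 2 <= j -> t j \in 'L_j(G).
Proof.
elim: j => // j IHj; rewrite leq_eqVlt => /predU1P[<-|lt2j].
  by rewrite lcn2 mem_commg.
by rewrite tS // lcn_comm ?IHj //; lia.
Qed.

Lemma lcn_subA j : 2 <= j -> 'L_j(G) \subset A.
Proof. by move=> j2; rewrite /= -lcn2 lcn_sub_leq. Qed.

Lemma sA j : 2 <= j -> s j \in A.
Proof. by move=> j2; rewrite (subsetP (lcn_subA j2)) ?s_lcn. Qed.

Lemma tA j : 2 <= j -> t j \in A.
Proof. by move=> j2; rewrite (subsetP (lcn_subA j2)) ?t_lcn. Qed.

Lemma s_tail i : m <= i -> s i = 1.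
Proof.
move=> mi; have := class_gt1 => m1.
apply/set1gP; rewrite -lcn_class (subsetP (lcn_sub_leq G mi)) ?s_lcn //; lia.
Qed.

(** The nilpotency class gives the bound [m], and t_(e+1) = 1 gives the bound [e.+1]. Both are kept
    because [e.+1 <= m] becomes known only after orders are counted. *)
Lemma t_tail i : minn m e.+1 <= i -> t i = 1.
Proof.
have m1 := class_gt1; rewrite geq_min => /orP[mi | ].
  by apply/set1gP; rewrite -lcn_class (subsetP (lcn_sub_leq G mi)) ?t_lcn //; lia.
elim: i => // i IHi; rewrite leq_eqVlt => /predU1P[<- // | lt_ei].
by rewrite tS ?IHi ?comm1g //; lia.
Qed.

Lemma t_tail_e i : e.+1 <= i -> t i = 1.
Proof. by move=> ei; rewrite t_tail // geq_min ei orbT. Qed.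

(** * The subgroups Sigma_i T_l, their directness, and the terms gamma_j for j >= 3 *)

Let memS := mem_chain (leqnn m) s_tail.
Let memT := mem_chain (leqnSn e.+1) t_tail_e.
Let subS := chain_sub m sA.
Let subT := chain_sub e.+2 tA.

Lemma R_sub i l : 2 <= i -> 2 <= l -> R i l \subset A.
Proof. by move=> i2 l2; rewrite join_subG subS ?subT. Qed.

Lemma conjA u v : u \in A -> v \in A -> u ^ v = u.
Proof.
by move=> Au Av; apply/conjg_fixP/commgP; apply: (centsP cAA).
Qed.

Lemma RP u i l : 2 <= i -> 2 <= l ->
  reflect (exists2 v, v \in S i & exists2 w, w \in T l & u = v * w) (u \in R i l).
Proof.
move=> i2 l2; rewrite /= norm_joinEl; last first.
  rewrite cents_norm // (subset_trans (subS i2)) // (subset_trans cAA) //.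
  exact: centS (subT l2).
apply: (iffP mulsgP) => [[v w Sv Tw ->] | [v Sv [w Tw ->]]].
  by exists v => //; exists w.
by exists v w.
Qed.

Lemma memRl u i l : u \in S i -> u \in R i l.
Proof. by apply/subsetP/joing_subl. Qed.

Lemma memRr u i l : u \in T l -> u \in R i l.
Proof. by apply/subsetP/joing_subr. Qed.

Lemma R_leq i l i' l' : i' <= i -> l' <= l -> R i l \subset R i' l'.
Proof.
move=> le_i le_l; apply: genS; apply: setUSS.
  exact: chain_leq (leqnn m) s_tail _ _ le_i.
exact: chain_leq (leqnSn e.+1) t_tail_e _ _ le_l.
Qed.

Lemma R_comm_x u i l : 3 <= i -> 3 <= l -> u \in R i l -> [~ u, x] \in S i.+1.
Proof.
move=> i3 l3 /RP[||v Sv [w Tw ->]]; try lia.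
have Svx : [~ v, x] \in S i.+1.
  by apply: (chain_comm cAA sA sS (leqnn m) s_tail) => //; lia.
rewrite commMgJ (chain_comm1 t_comm_x l3 Tw) mulg1 conjA //.
  by apply: subsetP Svx; apply: subS; lia.
by apply: subsetP Tw; apply: subT; lia.
Qed.

Lemma R_comm_y u i l : 3 <= i -> 3 <= l -> u \in R i l -> [~ u, y] \in T l.+1.
Proof.
move=> i3 l3 /RP[||v Sv [w Tw ->]]; try lia.
rewrite commMgJ (chain_comm1 s_comm_y i3 Sv) conj1g mul1g.
by apply: (chain_comm cAA tA tS (leqnSn e.+1) t_tail_e) => //; lia.
Qed.

Lemma norm_R i l : 3 <= i -> 3 <= l -> G \subset 'N(R i l).
Proof.
move=> i3 l3; rewrite {1}G_gen gen_subG subUset !sub1set.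
apply/andP; split; apply: mem_norm_comm => u Ru.
  apply: memRl; apply: (subsetP (chain_leq (leqnn m) s_tail (leqnSn i))).
  exact: R_comm_x Ru.
apply: memRr; apply: (subsetP (chain_leq (leqnSn e.+1) t_tail_e (leqnSn l))).
exact: R_comm_y Ru.
Qed.

Lemma R_comm i l u g : 3 <= i -> 3 <= l ->
  u \in R i l -> g \in G -> [~ u, g] \in R i.+1 l.+1.
Proof.
move=> i3 l3 Ru; apply: (comm_gen2 _ G_gen) => //; first by apply: norm_R; lia.
  by apply: memRl; apply: R_comm_x Ru.
by apply: memRr; apply: R_comm_y Ru.
Qed.

Lemma R_sub_lcn j : 2 <= j -> R j j \subset 'L_j(G).
Proof.
move=> j2; rewrite join_subG; apply/andP; split; apply: chain_subP => i le_ji.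
  by rewrite (subsetP (lcn_sub_leq G le_ji)) // s_lcn; lia.
by rewrite (subsetP (lcn_sub_leq G le_ji)) // t_lcn; lia.
Qed.

Lemma lcnE j : 3 <= j -> 'L_j(G) = R j j :> {set gT}.
Proof.
elim: j => // j IHj; rewrite leq_eqVlt => /predU1P[<- | lt2j]; last first.
  apply/eqP; rewrite eqEsubset R_sub_lcn ?andbT; last by lia.
  case: j lt2j IHj => // j lt2j IHj; rewrite lcnSn IHj // gen_subG.
  by apply/subsetP=> _ /imset2P[u g Ru Gg ->]; apply: R_comm.
apply/eqP; rewrite eqEsubset R_sub_lcn // andbT.
have nR := norm_R (leqnn 3) (leqnn 3).
(* Since gamma_4 = [gamma_3, G], the generation hypothesis puts gamma_3 inside the product of
   [R 3 3] and [gamma_3, G]; nilpotency removes the second factor. *)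
apply: (nil_sub_comm G_nil) => //; [exact: lcn_sub | exact: norm_lcn |].
have nL4R : 'L_4(G) \subset 'N(R 3 3) := subset_trans (lcn_sub 4 G) nR.
rewrite /= -(lcnSn 2) -norm_joinEr // {1}L3_gen gen_subG subUset joing_subr andbT.
rewrite subUset !sub1set.
by rewrite !(subsetP (joing_subl (R 3 3) _)) // mem_gen // inE ?memS ?memT ?orbT.
Qed.

(** Uniqueness of the factorization: if vw = v'w', then v'^-1 v = w' w^-1 lies in the trivial
    intersection of Sigma_3 and T_3. *)
Lemma R_mulP i l v w : 3 <= i -> 3 <= l -> v \in S 3 -> w \in T 3 ->
  v * w \in R i l -> (v \in S i) /\ (w \in T l).
Proof.
move=> i3 l3 Sv Tw /RP[||v' Sv' [w' Tw' eq_vw]]; try lia.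
have /set1gP v'v : v'^-1 * v \in [1 gT].
  rewrite -TI3 inE groupM ?groupV //=; last first.
    exact: (subsetP (chain_leq (leqnn m) s_tail i3)).
  have -> : v'^-1 * v = w' * w^-1.
    by apply: (mulgI v'); apply: (mulIg w); rewrite mulKVg mulgA mulgKV eq_vw.
  by rewrite groupM ?groupV // (subsetP (chain_leq (leqnSn e.+1) t_tail_e l3)).
have eq_v : v = v' by apply/eqP; rewrite eq_sym eq_mulVg1 v'v.
by split; [rewrite eq_v | move: eq_vw; rewrite eq_v => /mulgI ->].
Qed.

Lemma R_memS i l v : 3 <= i -> 3 <= l -> v \in S 3 -> v \in R i l -> v \in S i.
Proof. by move=> i3 l3 Sv; rewrite -{1}[v]mulg1 => /R_mulP[] //; apply: group1. Qed.

Lemma R_memT i l w : 3 <= i -> 3 <= l -> w \in T 3 -> w \in R i l -> w \in T l.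
Proof. by move=> i3 l3 Tw; rewrite -{1}[w]mul1g => /R_mulP[] //; apply: group1. Qed.

Lemma TI_chains i l : 3 <= i -> 3 <= l -> S i :&: T l = 1.
Proof.
move=> i3 l3; apply/trivgP; rewrite -TI3 setISS //.
  exact: chain_leq (leqnn m) s_tail _ _ i3.
exact: chain_leq (leqnSn e.+1) t_tail_e _ _ l3.
Qed.

Lemma card_R i l : 3 <= i -> 3 <= l -> #|R i l| = (#|S i| * #|T l|)%N.
Proof.
move=> i3 l3; have TI := TI_chains i3 l3.
rewrite -TI_cardMg //; apply: eq_card => u; apply/(RP _ (ltnW i3) (ltnW l3))/mulsgP.
  by case=> v Sv [w Tw ->]; exists v w.
by case=> v w Sv Tw ->; exists v => //; exists w.
Qed.

Lemma PE i l : 3 <= i -> 3 <= l -> P_ x y m e i l = R i l.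
Proof.
move=> i3 l3; have TI := TI_chains i3 l3.
rewrite /P_ -[Sigma_ x y m i]/(gval (S i)) -[T_ x y e l]/(gval (T l)).
rewrite dprodEY // (subset_trans (subT (ltnW l3))) //.
by rewrite (subset_trans cAA) ?centS ?subS 1?ltnW.
Qed.

(** * Powers by p, and the count of orders *)

Lemma expp_comm2 : s 2 ^+ p \in 'L_3(G).
Proof.
have nL g : g \in G -> g \in 'N('L_3(G)) := subsetP (norm_lcn 3) g.
(* Modulo gamma_3 the element [y, x] is central, so s_2^p is congruent to [y^p, x]; this lies in
   gamma_3 because y^p lies in G'. *)
have L3 : [~ y ^+ p, x] \in 'L_3(G).
  by rewrite lcn_comm // lcn2 expp_der1.
apply: coset_idr; rewrite ?nL // ?(subsetP (der_sub 1 G)) ?groupX ?sA //.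
rewrite -(coset_id L3) morphX ?nL ?groupR // !morphR ?nL ?groupX // morphX ?nL //.
rewrite commXg //; apply/commgP/eqP; rewrite -!morphR ?nL ?groupR //= coset_id //.
rewrite -invg_comm groupV lcn_comm //.
by rewrite lcn2 mem_commg.
Qed.

(** Since [u] and [u, g] commute inside the abelian group G', [u, g]^p = [u^p, g]. *)
Lemma expp_lcnS u g j : 2 <= j -> u \in 'L_j(G) -> g \in G ->
  u ^+ p \in 'L_j.+1(G) -> [~ u, g] ^+ p \in 'L_j.+2(G).
Proof.
move=> j2 Lu Gg Lup; have Au := subsetP (lcn_subA j2) _ Lu.
have Aug : [~ u, g] \in A by rewrite mem_commg // (subsetP (der_sub 1 G)).
by rewrite -commXg ?lcn_comm //; apply: (centsP cAA).
Qed.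

Lemma expp_s j : 2 <= j -> s j ^+ p \in 'L_j.+1(G).
Proof.
elim: j => // j IHj; rewrite leq_eqVlt => /predU1P[<-|j2]; first exact: expp_comm2.
by rewrite sS // expp_lcnS ?s_lcn ?IHj.
Qed.

Lemma expp_t j : 2 <= j -> t j ^+ p \in 'L_j.+1(G).
Proof.
elim: j => // j IHj; rewrite leq_eqVlt => /predU1P[<-|j2]; first exact: expp_comm2.
by rewrite tS // expp_lcnS ?t_lcn ?IHj.
Qed.

Lemma expp_sS j : 3 <= j -> s j ^+ p \in S j.+1.
Proof.
move=> j3; apply: (@R_memS _ j.+1); try lia; first by rewrite groupX ?memS.
by rewrite -lcnE ?expp_s //; lia.
Qed.

Lemma expp_tT j : 3 <= j -> t j ^+ p \in T j.+1.
Proof.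
move=> j3; apply: (@R_memT j.+1); try lia; first by rewrite groupX ?memT.
by rewrite -lcnE ?expp_t //; lia.
Qed.

(** The right-hand side is normal, as it lies between gamma_3 and gamma_2; modulo it the generators
    [x] and [y] commute, so the quotient is abelian. *)
Lemma L2_gen : 'L_2(G) = <<s 2 |: 'L_3(G)>>.
Proof.
have sKL : <<s 2 |: 'L_3(G)>> \subset 'L_2(G).
  by rewrite gen_subG subUset sub1set s_lcn // lcn_sub_leq.
apply/eqP; rewrite eqEsubset sKL andbT.
have nKG : G \subset 'N(<<s 2 |: 'L_3(G)>>).
  rewrite -commg_subr commGC; apply: subset_trans (commSg _ sKL) _.
  by rewrite -(lcnSn 1) sub_gen ?subsetUr.
have comm_yx g : g \in G -> [~ x, g] \in <<s 2 |: 'L_3(G)>>.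
  apply: (comm_gen2 nKG G_gen); rewrite ?commgg ?group1 //.
  by rewrite -invg_comm groupV mem_gen ?setU11.
rewrite lcn2 gen_subG; apply/subsetP=> _ /imset2P[u v Gu Gv ->].
rewrite -invg_comm groupV; move: u Gu; apply: (comm_gen2 nKG G_gen).
  by rewrite -invg_comm groupV comm_yx.
rewrite -invg_comm groupV; move: v Gv; apply: (comm_gen2 nKG G_gen).
  by rewrite mem_gen ?setU11.
by rewrite commgg group1.
Qed.

Lemma chain_orders :
  [/\ e.+1 <= m, #|A| = (p * #|R 3 3|)%N, #|S 3| = (p ^ (m - 3))%N &
     #|T 3| = (p ^ (e.+1 - 3))%N].
Proof.
have dS := card_chain_dvdn cAA sA (leqnn m) s_tail p_pr expp_sS (leqnn 3).
(* Bounding T_3 through [minn m e.+1] rather than [e.+1] is what later yields [e.+1 <= m]. *)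
have le_N : minn m e.+1 <= e.+2 by rewrite geq_min leqnSn orbT.
have dT := card_chain_dvdn cAA tA le_N t_tail p_pr expp_tT (leqnn 3).
have dA : #|A| %| p * #|R 3 3|.
  have -> : A = <<s 2 |: 'L_3(G)>> :> {set gT} by rewrite /= -lcn2 L2_gen.
  rewrite -lcnE // card_adjoin_dvdn ?expp_s //.
  by rewrite (subsetP (norm_lcn 3)) // groupR.
have /(dvdn_pfactor _ _ p_pr)[a le_a oS] := dS.
have /(dvdn_pfactor _ _ p_pr)[b le_b oT] := dT.
have oR : #|R 3 3| = (p ^ (a + b))%N by rewrite card_R // oS oT expnD.
move: dA; rewrite oR -expnS => /(dvdn_pfactor _ _ p_pr)[c le_c oA].
have def_n : n = (2 + c)%N.
  by apply: (expnI (prime_gt1 p_pr)); rewrite -G_order card_G oA expnD.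
(* The case m = 2 is excluded before [m - 3] is used as a true difference: there G' = 1 and n = 2,
   so the coclass would be 1. *)
have m1 := class_gt1; have m2 : 2 < m.
  rewrite ltn_neqAle m1 andbT; apply/negP=> /eqP m2.
  have oA1 : #|A| = 1%N by rewrite /= -lcn2 m2 lcn_class cards1.
  have /(expnI (prime_gt1 p_pr)) : (p ^ c = p ^ 0)%N by rewrite -oA oA1.
  by move=> c0; clear -c0 m2 def_n G_coclass e_ge3; lia.
move: le_b; rewrite /minn; rewrite oA oS oT => le_b.
(* The bounds c <= 1 + a + b, a <= m - 3 and b <= min(m, e+1) - 3, against c + 2 = n = m + e - 2,
   leave no slack. *)
have [-> -> -> ?] : [/\ c = (1 + (a + b))%N, a = m - 3, b = e.+1 - 3 & e < m].
  move: le_b; case: ifP => lt_m le_b; split;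
  clear -le_a le_b le_c def_n m2 lt_m G_coclass e_ge3; lia.
by split=> //; rewrite -expnS.
Qed.

(** * Exact indices in both chains *)

Lemma le_em : e.+1 <= m. Proof. by case: chain_orders. Qed.

Lemma card_A : #|A| = (p * #|R 3 3|)%N. Proof. by case: chain_orders. Qed.

Let cardSpS := card_chain_pS cAA sA (leqnn m) s_tail p_pr expp_sS
  (let: And4 _ _ oS _ := chain_orders in oS).
Let cardTpS := card_chain_pS cAA tA (leqnSn e.+1) t_tail_e p_pr expp_tT
  (let: And4 _ _ _ oT := chain_orders in oT).
Let s_notin := chain_notin cAA sA (leqnn m) s_tail p_pr expp_sS
  (let: And4 _ _ oS _ := chain_orders in oS).
Let t_notin := chain_notin cAA tA (leqnSn e.+1) t_tail_e p_pr expp_tT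
  (let: And4 _ _ _ oT := chain_orders in oT).
Let S_expp := chain_expp cAA sA (leqnn m) s_tail p_pr expp_sS
  (let: And4 _ _ oS _ := chain_orders in oS).
Let T_expp := chain_expp cAA tA (leqnSn e.+1) t_tail_e p_pr expp_tT
  (let: And4 _ _ _ oT := chain_orders in oT).
Let S_comm_inv := chain_comm_inv cAA sA sS (leqnn m) s_tail p_pr expp_sS
  (let: And4 _ _ oS _ := chain_orders in oS).
Let T_comm_inv := chain_comm_inv cAA tA tS (leqnSn e.+1) t_tail_e p_pr expp_tT
  (let: And4 _ _ _ oT := chain_orders in oT).

Lemma S_leq i j : i <= j -> S j \subset S i.
Proof. exact: chain_leq (leqnn m) s_tail i j. Qed.

Lemma T_leq i j : i <= j -> T j \subset T i.
Proof. exact: chain_leq (leqnSn e.+1) t_tail_e i j. Qed.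

Lemma s_notin_R i l j : 3 <= j < m -> j < i -> 3 <= l -> s j \notin R i l.
Proof.
move=> jm lt_ji l3; apply/negP=> Rs; have /andP[j3 _] := jm.
have Ss : s j \in S i by apply: (@R_memS i l); rewrite ?memS //; lia.
by have /negP[] := s_notin jm; apply: (subsetP (S_leq lt_ji)).
Qed.

Lemma t_notin_R i l j : 3 <= j < e.+1 -> j < l -> 3 <= i -> t j \notin R i l.
Proof.
move=> je lt_jl i3; apply/negP=> Rt; have /andP[j3 _] := je.
have Tt : t j \in T l by apply: (@R_memT i l); rewrite ?memT //; lia.
by have /negP[] := t_notin je; apply: (subsetP (T_leq lt_jl)).
Qed.

Lemma s2_notin : s 2 \notin 'L_3(G).
Proof.
apply/negP=> L3s; have := card_A; rewrite -lcnE // [#|A|](_ : _ = #|'L_3(G)|).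
  by apply/eqP; rewrite neq_ltn ltn_Pmull ?cardG_gt0 ?prime_gt1.
by rewrite /= -lcn2 L2_gen (setUidPr _) ?sub1set // genGid.
Qed.

(** * The maximal subgroups generated by G' and one of the two generators *)

Lemma joingA_index z w (H : {group gT}) : G :=: <<[set z; w]>> ->
  <<w |: A>> \subset H -> H \subset G -> z \notin H -> H :=: <<w |: A>>.
Proof.
move=> defG sKH sHG Hz.
have [Gz Gw] : z \in G /\ w \in G by rewrite defG !mem_gen ?set21 ?set22.
have sAK : A \subset <<w |: A>> by rewrite sub_gen ?subsetUr.
apply: (prime_index_eq p_pr sKH sHG _ Gz Hz).
have defzK : G :=: <<z |: <<w |: A>>>>.
  apply/eqP; rewrite eqEsubset gen_subG !subUset !sub1set Gz.
  rewrite gen_subG subUset sub1set Gw der_sub.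
  rewrite andbT {1}defG gen_subG subUset !sub1set mem_gen ?setU11 //.
  by rewrite mem_gen // inE mem_gen ?setU11 ?orbT.
rewrite {1}defzK card_adjoin_dvdn ?(subsetP sAK) ?expp_der1 //.
by rewrite (subsetP (sub_der1_norm sAK _)) // (subset_trans sKH).
Qed.

(** Otherwise this subgroup would be all of [G], whose order p^2 |G'| does not divide p |G'|. *)
Lemma joingA_notin z w : G :=: <<[set z; w]>> -> z \notin <<w |: A>>.
Proof.
move=> defG; apply/negP=> Kz.
have [Gz Gw] : z \in G /\ w \in G by rewrite defG !mem_gen ?set21 ?set22.
have sGK : G \subset <<w |: A>>.
  by rewrite defG gen_subG subUset !sub1set Kz mem_gen ?setU11.
have : #|<<w |: A>>| %| p * #|A|.
  by rewrite card_adjoin_dvdn ?expp_der1 // (subsetP (der_norm 1 G)).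
move/(dvdn_trans (cardSg sGK)); rewrite card_G -mulnn -mulnA dvdn_pmul2l ?prime_gt0 //.
rewrite -[X in _ %| X]mul1n dvdn_pmul2r ?cardG_gt0 // dvdn1.
by rewrite eqn_leq leqNgt prime_gt1.
Qed.

(** The elements centralizing [u] modulo [K] form a subgroup that contains [w] and G' but not [z],
    so maximality pins it down. A single test element [u] thus bounds a two-step centralizer. *)
Lemma comm_mod_sub K u g z w : G :=: <<[set z; w]>> -> G \subset 'N(gval K) ->
    (forall d, d \in A -> [~ u, d] \in K) -> [~ u, w] \in K -> [~ u, z] \notin K ->
  g \in G -> [~ u, g] \in K -> g \in <<w |: A>>.
Proof.
move=> defG nKG AK Kw Kz Gg Kg.
have [Gz Gw] : z \in G /\ w \in G by rewrite defG !mem_gen ?set21 ?set22.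
rewrite -(@joingA_index z w (Group (comm_mod_group_set u nKG)) defG).
- by rewrite inE Gg.
- rewrite gen_subG subUset sub1set inE Gw Kw; apply/subsetP=> d Ad.
  by rewrite inE AK // (subsetP (der_sub 1 G)).
- by apply/subsetP=> d; rewrite inE => /andP[].
by rewrite inE negb_and Kz orbT.
Qed.

Lemma G_genC : G :=: <<[set y; x]>>. Proof. by rewrite setUC. Qed.

Lemma joingA_cap g : g \in <<x |: A>> -> g \in <<y |: A>> -> g \in A.
Proof.
move=> Kxg Kyg; have Ix := joingA_notin G_gen.
suff <- : [group of <<x |: A>> :&: <<y |: A>>] :=: A by rewrite inE Kxg.
apply: (prime_index_eq p_pr _ (subsetIl _ _) _ _ (_ : x \notin _)).
- by rewrite subsetI !sub_gen ?subsetUr.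
- by rewrite card_adjoin_dvdn ?expp_der1 // (subsetP (der_norm 1 G)).
- by rewrite mem_gen ?setU11.
by rewrite inE negb_and Ix orbT.
Qed.

(** * Two-step centralizers *)

Lemma commAA u d K : u \in A -> d \in A -> [~ u, d] \in gval K.
Proof. by move=> Au Ad; have /eqP-> // : [~ u, d] == 1; apply/commgP/(centsP cAA). Qed.

Lemma commGA u d : u \in G -> d \in A -> [~ u, d] \in 'L_3(G).
Proof. by move=> Gu Ad; rewrite -invg_comm groupV lcn_comm // lcn2. Qed.

Lemma comm_x_L3 g : g \in G -> [~ x, g] \in 'L_3(G) -> g \in <<x |: A>>.
Proof.
apply: (comm_mod_sub G_genC (norm_lcn 3)) => [d||].
- exact: commGA.
- by rewrite commgg group1.
by rewrite -invg_comm groupV s2_notin.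
Qed.

Lemma comm_y_L3 g : g \in G -> [~ y, g] \in 'L_3(G) -> g \in <<y |: A>>.
Proof.
apply: (comm_mod_sub G_gen (norm_lcn 3)) => [d||].
- exact: commGA.
- by rewrite commgg group1.
exact: s2_notin.
Qed.

Lemma centralizes_A j : 0 < j -> centralizes_two_steps j G A.
Proof.
(* The condition on G' is inherited from the largest candidate, which contains G'. *)
case/(two_step_centralizer_max G)=> /and3P[sAX _ cX] _.
by rewrite /centralizes_two_steps subxx der_sub (subset_trans (commgS _ sAX)).
Qed.

Lemma comm_yx_sub K u g : G \subset 'N(gval K) -> u \in A ->
    [~ u, y] \in K -> [~ u, x] \notin K ->
  g \in G -> [~ u, g] \in K -> g \in <<y |: A>>.
Proof.
by move=> nKG Au; apply: (comm_mod_sub G_gen nKG) => d; apply: commAA.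
Qed.

Lemma comm_xy_sub K u g : G \subset 'N(gval K) -> u \in A ->
    [~ u, x] \in K -> [~ u, y] \notin K ->
  g \in G -> [~ u, g] \in K -> g \in <<x |: A>>.
Proof.
by move=> nKG Au; apply: (comm_mod_sub G_genC nKG) => d; apply: commAA.
Qed.

Lemma two_step_low j : 1 <= j <= e - 1 -> two_step_centralizer j G = A.
Proof.
move=> /andP[j1 le_je]; have le_em := le_em.
apply: two_step_centralizer_eq (centralizes_A j1) _ => H /and3P[_ sHG cH].
apply/subsetP=> g Hg; have Gg := subsetP sHG g Hg.
have cg u : u \in 'L_j(G) -> [~ u, g] \in 'L_j.+2(G).
  by move=> Lu; rewrite (subsetP cH) ?mem_commg.
case: (ltngtP j 2) => [lt_j2 | lt_2j | j2].
- have j_1 : j = 1%N by lia.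
  by rewrite j_1 lcn1 in cg; rewrite joingA_cap ?comm_x_L3 ?comm_y_L3 ?cg.
(* For j >= 3 the test element s_j forces g into <y, G'> and t_j forces it into <x, G'>; the bound j
   <= e - 1 keeps t_(j+1) outside gamma_(j+2). *)
- have [Lsg Ltg] := (cg _ (s_lcn (ltnW lt_2j)), cg _ (t_lcn (ltnW lt_2j))).
  rewrite joingA_cap //.
    apply: comm_xy_sub (norm_lcn j.+2) (tA (ltnW lt_2j)) _ _ Gg Ltg.
      by rewrite t_comm_x ?group1.
    by rewrite -tS 1?ltnW //= lcnE ?t_notin_R //; lia.
  apply: comm_yx_sub (norm_lcn j.+2) (sA (ltnW lt_2j)) _ _ Gg Lsg.
    by rewrite s_comm_y ?group1.
  by rewrite -sS 1?ltnW //= lcnE ?s_notin_R //; lia.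
(* For j = 2 the only test element is s_2 = t_2, moved by both generators modulo gamma_4. Enlarging
   gamma_4 to [R 3 4] absorbs s_3 but not t_3, and [R 4 3] does the opposite, so s_2 serves
   twice. *)
have {cg} : [~ s 2, g] \in R 4 4 by rewrite -lcnE // -j2 cg // j2 s_lcn.
move=> R44; have R34 := subsetP (R_leq (leqnSn 3) (leqnn 4)) _ R44.
have R43 := subsetP (R_leq (leqnn 4) (leqnSn 3)) _ R44.
rewrite joingA_cap //.
  apply: comm_xy_sub (norm_R _ _) (sA (leqnn 2)) _ _ Gg R34 => //.
    by rewrite -sS // memRl ?memS.
  by rewrite -[s 2]/(t 2) -tS // t_notin_R //; lia.
apply: comm_yx_sub (norm_R _ _) (sA (leqnn 2)) _ _ Gg R43 => //.
  by rewrite -[s 2]/(t 2) -tS // memRr ?memT.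
by rewrite -sS // s_notin_R //; lia.
Qed.

Lemma two_step_mid j : e <= j <= m - 2 -> two_step_centralizer j G = <<y |: A>>.
Proof.
move=> jem; have le_em := le_em; have j3 : 2 < j by lia.
have sKG : <<y |: A>> \subset G by rewrite gen_subG subUset sub1set gen_memy der_sub.
apply: (@two_step_centralizer_eq _ _ _ [group of <<y |: A>>]) => [|H /and3P[_ sHG cH]].
  apply/and3P; split=> //=; first by rewrite sub_gen ?subsetUr.
  rewrite gen_subG.
  apply/subsetP=> _ /imset2P[u g Lu Kg ->].
  have Au := subsetP (lcn_subA (ltnW j3)) u Lu.
  suff : <<y |: A>> \subset Group (comm_mod_group_set u (norm_lcn j.+2)).
    by move/subsetP/(_ g Kg); rewrite inE => /andP[].
  rewrite gen_subG subUset sub1set inE gen_memy /=; apply/andP; split; last first.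
    by apply/subsetP=> d Ad; rewrite inE commAA // (subsetP (der_sub 1 G)).
  rewrite lcnE // in Lu.
  have := R_comm_y j3 j3 Lu; rewrite /= (chain1 _ t_tail_e) => [/set1gP->|].
    exact: group1.
  by lia.
apply/subsetP=> g Hg; have Gg := subsetP sHG g Hg.
apply: (comm_yx_sub (norm_lcn j.+2) (sA (ltnW j3))) => //.
- by rewrite s_comm_y ?group1.
- by rewrite -sS 1?ltnW //= lcnE ?s_notin_R //; lia.
by rewrite (subsetP cH) ?mem_commg ?s_lcn // ltnW.
Qed.

Lemma two_step_high j : 1 <= j -> m - 1 <= j -> two_step_centralizer j G = G.
Proof.
case: j => // j _ le_mj; apply: two_step_centralizer_eq => [|H /and3P[]] //.
rewrite /centralizes_two_steps der_sub subxx /= -lcnSn.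
have /trivgP-> : 'L_j.+2(G) \subset [1 gT] by rewrite -lcn_class lcn_sub_leq //; lia.
exact: sub1G.
Qed.

(** The middle range of indices is empty, so only [G] and G', of index p^2, occur. *)
Lemma two_step_not_maximal j (M : {group gT}) : e = (m - 1)%N ->
  1 <= j -> maximal M G -> two_step_centralizer j G <> M.
Proof.
move=> em j1 maxM; have [le_je | lt_ej] := leqP j (e - 1); last first.
  rewrite two_step_high //; last by lia.
  by move=> GM; have := maxgroupp maxM; rewrite /= -GM properxx.
rewrite two_step_low ?j1 // => AM.
have := p_maximal_index G_pgroup maxM; rewrite -divgS -?AM ?der_sub //.
rewrite card_G mulnK // => /eqP; rewrite -mulnn -[X in _ == X]muln1.
by rewrite eqn_pmul2l ?prime_gt0 // eqn_leq leqNgt prime_gt1.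
Qed.

(** * Factors and terms of the lower central series *)

Lemma R_factor_pp (B K : {group gT}) i l : 3 <= i < m -> 3 <= l < e.+1 ->
  B :=: R i l -> K :=: R i.+1 l.+1 -> is_type_pp p (B / K).
Proof.
move=> im le /group_inj-> /group_inj->.
have [i3 l3] : 3 <= i /\ 3 <= l by lia.
apply: is_type_pp_quotient => // [|||u /RP[||v Sv [w Tw ->]]]; try lia.
- by apply: abelianS cAA; apply: R_sub; lia.
- exact: R_leq.
- rewrite (card_R i3 l3) (card_R (leqW i3) (leqW l3)) /=.
  by rewrite (cardSpS im) (cardTpS le) -mulnn mulnACA.
rewrite expgMn; last first.
  apply: (centsP cAA); first exact: subsetP (subS (ltnW i3)) v Sv.
  exact: subsetP (subT (ltnW l3)) w Tw.
apply: groupM; first exact: memRl (S_expp im Sv).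
exact: memRr (T_expp le Tw).
Qed.

(** The hypothesis on [l'] covers two situations: both T-parts trivial, in the lower central series,
    and both equal to T_3, in the upper one. *)
Lemma R_factor_p (B K : {group gT}) i l l' :
    3 <= i < m -> 3 <= l -> 3 <= l' -> T l' = T l ->
  B :=: R i l -> K :=: R i.+1 l' -> is_type_p p (B / K).
Proof.
move=> im l3 l'3 eT /group_inj-> /group_inj->; have /andP[i3 _] := im.
have i13 : 2 < i.+1 by apply: ltnW.
apply: is_type_p_quotient => //.
- apply: subset_trans (norm_R i13 l'3).
  by rewrite (subset_trans (R_sub _ _)) ?der_sub // ltnW.
- by rewrite eT; apply: R_leq.
by rewrite !card_R // eT /= (cardSpS im) mulnA.
Qed.

Lemma lcn_factor_pp j : j = 1%N \/ 3 <= j <= e -> is_type_pp p ('L_j(G) / 'L_j.+1(G)).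
Proof.
have le_em := le_em; case=> [-> | je]; first by rewrite lcn1 lcn2.
by apply: (@R_factor_pp 'L_j(G)%G 'L_j.+1(G)%G j j); rewrite /= ?lcnE //; lia.
Qed.

(** Stated up to equality of sets because G' / gamma_3 serves both as gamma_2 / gamma_3 and as
    zeta_(m-2) / zeta_(m-3). *)
Lemma der1_factor_p (B K : {group gT}) :
  B :=: A -> K :=: 'L_3(G) -> is_type_p p (B / K).
Proof.
move=> /group_inj-> /(@group_inj _ _ 'L_3(G)%G)->; apply: is_type_p_quotient => //.
- exact: subset_trans (der_sub 1 G) (norm_lcn 3).
- exact: lcn_subA.
by rewrite /= lcnE // card_A.
Qed.

Lemma lcn_factor_p j : j = 2 \/ e + 1 <= j <= m - 1 ->
  is_type_p p ('L_j(G) / 'L_j.+1(G)).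
Proof.
have le_em := le_em; case=> [-> | je].
  by apply: (@der1_factor_p 'L_2(G)%G 'L_3(G)%G); rewrite //= lcn2.
apply: (@R_factor_p 'L_j(G)%G 'L_j.+1(G)%G j j j.+1); rewrite /= ?lcnE //; try lia.
by apply: group_inj; rewrite /= !(chain1 _ t_tail_e) //; lia.
Qed.

Lemma lcn_Sigma j : e + 1 <= j <= m - 1 -> 'L_j(G) = Sigma_ x y m j.
Proof.
move=> je; rewrite lcnE /=; last by lia.
rewrite (chain1 _ t_tail_e); last by lia.
by rewrite joingG1.
Qed.

Lemma lcn_P j : 3 <= j <= e -> 'L_j(G) = P_ x y m e j j.
Proof. by case/andP=> j3 _; rewrite lcnE // PE. Qed.

Lemma L1_gen : 'L_1(G) = <<[set x; y] :|: G^`(1)>>.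
Proof.
rewrite lcn1; apply/eqP; rewrite eqEsubset gen_subG !subUset !sub1set.
by rewrite gen_memx gen_memy der_sub {1}G_gen genS ?subsetUl.
Qed.

(** * Terms and factors of the upper central series *)

Lemma ucn_step (Z Z' : {group gT}) j : 'Z_j(G) = Z ->
    (forall g, (g \in Z') = [&& g \in G, [~ g, x] \in Z & [~ g, y] \in Z]) ->
  'Z_j.+1(G) = Z'.
Proof.
move=> defZ defZ'; apply/setP=> g; rewrite ucnSnR inE defZ defZ'.
case Gg: (g \in G) => //=.
have nZ : G \subset 'N(Z) by rewrite -defZ gFnorm.
apply/idP/andP=> [sZ | [Zx Zy]].
  by split; apply: (subsetP sZ); rewrite mem_commg ?set11.
rewrite gen_subG; apply/subsetP=> _ /imset2P[_ h /set1P-> Gh ->].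
exact: comm_gen2 nZ G_gen Zx Zy h Gh.
Qed.

Lemma comm_xy_der1 g : g \in G -> [~ g, x] \in 'L_3(G) -> [~ g, y] \in 'L_3(G) ->
  g \in A.
Proof.
move=> Gg gx gy; rewrite joingA_cap ?comm_x_L3 ?comm_y_L3 //.
  by rewrite -invg_comm groupV.
by rewrite -invg_comm groupV.
Qed.

(** [R 3 3] has index p in G', and s_2 violates the condition because [s_2, x] = s_3 is outside
    [R 4 3]. *)
Lemma comm_x_der1 g : g \in A -> [~ g, x] \in R 4 3 -> g \in R 3 3.
Proof.
move=> Ag Rgx; have le_em := le_em.
have nR : A \subset 'N(R 4 3) by rewrite (subset_trans (der_sub 1 G)) ?norm_R.
suff <- : Group (mod_comm_group_set x nR) :=: R 3 3 by rewrite inE Ag.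
apply: (prime_index_eq p_pr _ _ _ (_ : s 2 \in A)).
- apply/subsetP=> u Ru; rewrite inE (subsetP (R_sub (leqnSn 2) (leqnSn 2))) //=.
  by apply: memRl; apply: R_comm_x Ru.
- by apply/subsetP=> u; rewrite inE => /andP[].
- by rewrite card_A.
- exact: sA.
by rewrite inE sA // -sS // s_notin_R //; lia.
Qed.

(** Each step lowers both indices by one; the T-index reaches 3 first, or at the same time, and then
    stays there, which the [maxn] records. *)
Lemma ucnE j : j <= m - 3 -> 'Z_j(G) = R (m - j) (maxn 3 (e.+1 - j)) :> {set gT}.
Proof.
have le_em := le_em; elim: j => [|j IHj] le_j.
  rewrite ucn0 /= !subn0 (maxn_idPr _); last by lia.
  by rewrite (chain1 _ s_tail) // (chain1 _ t_tail_e) // joing1G.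
have {}IHj := IHj (ltnW le_j).
(* The indices are abstracted. Either l = 3, so that T_l imposes no condition, or l1 = l + 1 and
   commutation with [y] can be inverted. *)
have [i [l [l1 [[def_i def_l def_i1 def_l1] im [l3 l13 le_l1 lP]]]]] :
    exists i l l1 : nat, [/\ [/\ (m - j.+1 = i)%N, maxn 3 (e.+1 - j.+1) = l,
      (m - j = i.+1)%N & maxn 3 (e.+1 - j) = l1], 3 <= i < m &
      [/\ 3 <= l, 3 <= l1, l1 <= l.+1 & l = 3 \/ l1 = l.+1 /\ l < e.+1]].
  exists (m - j.+1)%N, (maxn 3 (e.+1 - j.+1)), (maxn 3 (e.+1 - j)).
  by clear -le_j; do ?split; lia.
rewrite def_i def_l; rewrite def_i1 def_l1 in IHj; have /andP[i3 _] := im.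
apply: (ucn_step IHj) => g; apply/idP/and3P=> [Rg | [Gg gx gy]].
  have Gg : g \in G.
    by rewrite (subsetP (der_sub 1 G)) // (subsetP (R_sub (ltnW i3) (ltnW l3))).
  have Rgh h : h \in G -> [~ g, h] \in R i.+1 l1.
    by move=> Gh; apply: (subsetP (R_leq (leqnn _) le_l1)) (R_comm i3 l3 Rg Gh).
  by rewrite Gg !Rgh.
have sR3 : R i.+1 l1 \subset R 3 3 by apply: R_leq => //; apply: ltnW.
(* Commuting with both generators modulo gamma_3 puts g in G', and then its commutator with [x] puts
   it in gamma_3. So g = vw, and [g, x] = [v, x], [g, y] = [w, y] separate the two chains. *)
have Ag : g \in A by rewrite comm_xy_der1 ?lcnE // (subsetP sR3).
have R3g : g \in R 3 3.
  by apply: comm_x_der1 Ag _; apply: subsetP gx; apply: R_leq.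
have /RP[||v Sv [w Tw def_g]] // := R3g.
have Av := subsetP (subS (leqnSn 2)) v Sv; have Aw := subsetP (subT (leqnSn 2)) w Tw.
rewrite def_g commMgJ (chain_comm1 t_comm_x (leqnn 3) Tw) mulg1 conjA // in gx; last first.
  by rewrite mem_commg // (subsetP (der_sub 1 G)).
rewrite def_g commMgJ (chain_comm1 s_comm_y (leqnn 3) Sv) conj1g mul1g in gy.
have Svx : [~ v, x] \in S i.+1.
  apply: R_memS gx => //; first exact: ltnW.
  exact: (subsetP (S_leq (leqnSn 3))) (chain_comm cAA sA sS (leqnn m) s_tail _ Sv).
have Twy : [~ w, y] \in T l1.
  apply: R_memT gy => //; first exact: ltnW.
  exact: (subsetP (T_leq (leqnSn 3))) (chain_comm cAA tA tS (leqnSn e.+1) t_tail_e _ Tw).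
rewrite def_g groupM //; first exact: memRl (S_comm_inv im Sv Svx).
apply: memRr; case: lP => [-> // | [l1l lt_le]].
by rewrite l1l in Twy; apply: T_comm_inv Tw Twy; rewrite l3.
Qed.

Lemma ucn_L3 : 'Z_(m - 3)(G) = 'L_3(G).
Proof.
have le_em := le_em; rewrite ucnE // lcnE //; have -> : m - (m - 3) = 3 by lia.
by have -> : maxn 3 (e.+1 - (m - 3)) = 3 by lia.
Qed.

Lemma ucn_der1 : 'Z_(m - 2)(G) = A.
Proof.
have le_em := le_em; have -> : m - 2 = (m - 3).+1 by lia.
apply: (@ucn_step 'L_3(G)%G); first exact: ucn_L3.
move=> g; apply/idP/and3P=> [Ag | []]; last exact: comm_xy_der1.
by rewrite (subsetP (der_sub 1 G)) // !lcn_comm // lcn2.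
Qed.

Lemma ucn_G : 'Z_(m - 1)(G) = G.
Proof. by apply/(ucn_nil_classP _ G_nil); rewrite G_class. Qed.

Lemma ucn_low j : 1 <= j <= e - 2 -> 'Z_j(G) = P_ x y m e (m - j) (e + 1 - j).
Proof.
have le_em := le_em => je; rewrite ucnE; last by lia.
by rewrite PE ?addn1 ?(maxn_idPr _) //; lia.
Qed.

Lemma ucn_mid j : e - 1 <= j <= m - 3 -> 'Z_j(G) = P_ x y m e (m - j) 3.
Proof.
have le_em := le_em => je; rewrite ucnE; last by lia.
by rewrite PE ?(maxn_idPl _) //; lia.
Qed.

Lemma ucn_factor_pp j : 1 <= j <= e - 2 \/ j = (m - 1)%N ->
  is_type_pp p ('Z_j(G) / 'Z_(j - 1)(G)).
Proof.
have le_em := le_em; case=> [je | ->]; last first.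
  by rewrite ucn_G (_ : m - 1 - 1 = m - 2) ?ucn_der1 //; lia.
apply: (@R_factor_pp 'Z_j(G)%G 'Z_(j - 1)(G)%G (m - j) (e.+1 - j)); try lia.
  by rewrite /= ucnE ?(maxn_idPr _) //; lia.
rewrite /= ucnE ?(maxn_idPr _); try lia.
have -> : m - (j - 1) = (m - j).+1 by lia.
by have -> : e.+1 - (j - 1) = (e.+1 - j).+1 by lia.
Qed.

Lemma ucn_factor_p j : e - 1 <= j <= m - 2 ->
  is_type_p p ('Z_j(G) / 'Z_(j - 1)(G)).
Proof.
have le_em := le_em => /andP[ej]; rewrite leq_eqVlt => /predU1P[-> | jm].
  apply: (@der1_factor_p 'Z_(m - 2)(G)%G 'Z_(m - 2 - 1)(G)%G); rewrite /= ?ucn_der1 //.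
  by rewrite -ucn_L3; congr 'Z__(G); lia.
apply: (@R_factor_p 'Z_j(G)%G 'Z_(j - 1)(G)%G (m - j) 3 3) => //; first by lia.
  by rewrite /= ucnE ?(maxn_idPl _) //; lia.
rewrite /= ucnE ?(maxn_idPl _); try lia.
by have -> : m - (j - 1) = (m - j).+1 by lia.
Qed.

End DefectZero.

Theorem corollary2p2
    (p : nat) (gT : finGroupType) (G : {group gT}) (x y : gT) (n m e : nat)
    (p_prime : prime p) (p_odd : odd p)
    (G_pgroup : p.-group G) (G_gen : G = <<[set x; y]>> :> {set gT})
    (G_metabelian : abelian G^`(1)) (G_ab : is_type_pp p (G / G^`(1)))
    (G_order : #|G| = (p ^ n)%N) (G_class : nil_class G = (m - 1)%N)
    (G_coclass : (n - (m - 1))%N = (e - 1)%N) (G_coclass_ge2 : 2 <= e - 1)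
    (t3_notin : t_ x y 3 \notin Sigma_ x y m 3)
    (gamma3_gen : 'L_3(G) = <<[set s_ x y 3; t_ x y 3] :|: 'L_4(G)>>)
    (defect0 : commutativity_defect0 x y m e)
    (s_comm_y : forall j : nat, 3 <= j -> [~ s_ x y j, y] = 1)
    (t_comm_x : forall l : nat, 3 <= l -> [~ t_ x y l, x] = 1) :
  [/\
      [/\ forall j : nat, 1 <= j <= e - 1 -> two_step_centralizer j G = G^`(1),
          forall j : nat, e <= j <= m - 2 ->
            two_step_centralizer j G = <<y |: G^`(1)>>,
          forall j : nat, 1 <= j -> m - 1 <= j -> two_step_centralizer j G = G
        & e = (m - 1)%N -> forall (j : nat) (M : {group gT}),
            1 <= j -> maximal M G -> two_step_centralizer j G <> M],
      (forall j : nat, j = 1%N \/ 3 <= j <= e ->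
         is_type_pp p ('L_j(G) / 'L_j.+1(G))) /\
      (forall j : nat, j = 2 \/ e + 1 <= j <= m - 1 ->
         is_type_p p ('L_j(G) / 'L_j.+1(G))),
      [/\ 'L_1(G) = <<[set x; y] :|: G^`(1)>>,
          'L_2(G) = <<s_ x y 2 |: 'L_3(G)>>,
          forall j : nat, 3 <= j <= e -> 'L_j(G) = P_ x y m e j j
        & forall j : nat, e + 1 <= j <= m - 1 -> 'L_j(G) = Sigma_ x y m j],
      (forall j : nat, 1 <= j <= e - 2 \/ j = (m - 1)%N ->
         is_type_pp p ('Z_j(G) / 'Z_(j - 1)(G))) /\
      (forall j : nat, e - 1 <= j <= m - 2 ->
         is_type_p p ('Z_j(G) / 'Z_(j - 1)(G)))
    &
      [/\ forall j : nat, 1 <= j <= e - 2 ->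
            'Z_j(G) = P_ x y m e (m - j) (e + 1 - j),
          forall j : nat, e - 1 <= j <= m - 3 -> 'Z_j(G) = P_ x y m e (m - j) 3,
          'Z_(m - 2)(G) = <<s_ x y 2 |: 'Z_(m - 3)(G)>>
        & 'Z_(m - 1)(G) = <<[set x; y] :|: 'Z_(m - 2)(G)>>]].
Proof.
have [t_last TI] := defect0.
(* [Sigma_] and [T_] are instances of [chain] by conversion. *)
have TI3 : chain (s_ x y) m 3 :&: chain (t_ x y) e.+2 3 = 1 := TI.
have L2E : 'L_2(G) = <<s_ x y 2 |: 'L_3(G)>> by eapply L2_gen; eassumption.
have L1E : 'L_1(G) = <<[set x; y] :|: G^`(1)>> by exact: L1_gen.
have Z1 : 'Z_(m - 1)(G) = G by eapply ucn_G; eassumption.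
have Z2 : 'Z_(m - 2)(G) = G^`(1) by eapply ucn_der1; eassumption.
have Z3 : 'Z_(m - 3)(G) = 'L_3(G) by eapply ucn_L3; eassumption.
split.
- split=> [j jP | j jP | j j1 mj | em j M j1 maxM].
  + by eapply two_step_low; eassumption.
  + by eapply two_step_mid; eassumption.
  + by eapply two_step_high; eassumption.
  by eapply two_step_not_maximal; eassumption.
- split=> j jP; first by eapply lcn_factor_pp; eassumption.
  by eapply lcn_factor_p; eassumption.
- split=> [||j jP|j jP] //.
    by eapply lcn_P; eassumption.
  by eapply lcn_Sigma; eassumption.
- split=> j jP; first by eapply ucn_factor_pp; eassumption.
  by eapply ucn_factor_p; eassumption.
split=> [j jP|j jP||].
- by eapply ucn_low; eassumption.
- by eapply ucn_mid; eassumption.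
(* As zeta_(m-2) = gamma_2 and zeta_(m-3) = gamma_3, this is the generation of gamma_2 over
   gamma_3. *)
- by rewrite Z2 Z3 -L2E lcn2.
by rewrite Z1 Z2 -L1E lcn1.
Qed.
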